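(* Let $\mathcal{P}$ be a collection of Markov kernels on a measurable space $(\mathsf{X},\mathcal{B}(\mathsf{X}))$. Assume there exist a set $C\in\mathcal{B}(\mathsf{X})$, a measurable function $\hat V:\mathsf{X}\to[1,\infty)$ with $c_{\hat V}=\sup_{C}\hat V<\infty$, and constants $\beta>0$, $\alpha\in(0,1)$ and $b_{\hat V}<\infty$ such that for all $P\in\mathcal{P}$, $$P\hat V(x)\le\begin{cases}\hat V(x)-\beta\hat V^\alpha(x),&x\notin C,\\ b_{\hat V},&x\in C.\end{cases}$$ Furthermore, suppose that for every level set $A_{\hat V}(v)=\{x\in\mathsf{X}:\hat V(x)\le v\}$ there exist $\epsilon_v>0$ and probability measures $(\nu_P)_{P\in\mathcal{P}}$ on $(\mathsf{X},\mathcal{B}(\mathsf{X}))$ such that for all $P\in\mathcal{P}$, $P(x,\cdot)\ge\epsilon_v\nu_P(\cdot)$ for all $x\in A_{\hat V}(v)$. Then for any $\xi\in[0,1]$ and $\lambda\in[0,1)$ there exists a constant $c_*<\infty$ such that for all sequences $(P_k)_{k\ge1}\subset\mathcal{P}$, all measurable $f:\mathsf{X}\to\mathbb{R}$ with $\|f\|_{\hat V^{\alpha_{\lambda,\xi}}}<\infty$, where $\alpha_{\lambda,\xi}=\alpha(1-\lambda)(1-\xi)$, and all $x,x'\in\mathsf{X}$, $$\sum_{n\ge0}(n+1)^{\frac{\alpha(1-\lambda)\xi}{1-\alpha}}\big|P^{(n)}f(x)-P^{(n)}f(x')\big|\le c_*\,\|f\|_{\hat V^{\alpha_{\lambda,\xi}}}\big(\hat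 V^{1-\lambda\alpha}(x)+\hat V^{1-\lambda\alpha}(x')-1\big).$$
   Context: Notation: $Pf(x)=\int P(x,\mathrm{d}y)f(y)$; for a sequence of kernels $(P_k)_{k\ge1}$, $P^{(n)}=P_1P_2\cdots P_n$ (composition of kernels) for $n\ge1$ and $P^{(0)}f=f$. For $W:\mathsf{X}\to[1,\infty)$, $\|f\|_W=\sup_{x\in\mathsf{X}}|f(x)|/W(x)$. $\hat V^a(x)$ means $\hat V(x)^a$. *)

(* Defs.v *)
(* MathComp-Analysis *)
From HB Require Import structures.
From mathcomp Require Import all_boot all_order all_algebra.
From mathcomp Require Import all_classical all_reals all_analysis.

Set Implicit Arguments.
Unset Strict Implicit.
Unset Printing Implicit Defensive.
Import Order.TTheory GRing.Theory Num.Theory.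
Import numFieldNormedType.Exports.

Local Open Scope classical_set_scope.
Local Open Scope ring_scope.
Local Open Scope ereal_scope.

(* The library only equips [mkcomp_noparam] with the subprobability structure. *)
Section probability_kcomp_noparam.
Context d0 d1 d2 (T0 : measurableType d0) (T1 : measurableType d1)
  (T2 : measurableType d2) {R : realType}
  (k1 : R.-pker T0 ~> T1) (k2 : R.-pker T1 ~> T2).

Let prob_mkcomp_noparam x : mkcomp_noparam k1 k2 x [set: T2] = 1.
Proof.
rewrite /mkcomp_noparam /= /kcomp_noparam.
rewrite (eq_integral (fun=> 1)) => [|y _]; last exact: prob_kernel.
by rewrite integral_cst// mul1e; exact: prob_kernel.
Qed.

HB.instance Definition _ := isProbabilityKernel.Build
  _ _ _ _ R (mkcomp_noparam k1 k2) prob_mkcomp_noparam.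

End probability_kcomp_noparam.

(* P f (x); extended-real valued, so that no integrability of f is presupposed. *)
Definition kernel_app d (X : measurableType d) (R : realType)
    (P : R.-pker X ~> X) (f : X -> R) (x : X) : \bar R :=
  \int[P x]_y (f y)%:E.

(* P^(n) = P_1 P_2 ... P_n; the sequence is indexed from 1, and the value P 0
   is never used. P^(0) is the identity kernel x |-> \d_x. *)
Fixpoint kernel_prod d (X : measurableType d) (R : realType)
    (P : nat -> R.-pker X ~> X) (n : nat) : R.-pker X ~> X :=
  match n with
  | 0%N => kdirac (@measurable_id d X [set: X])
  | m.+1 => mkcomp_noparam (kernel_prod P m) (P m.+1)
  end.

Definition wnorm (T : Type) (R : realType) (W f : T -> R) : \bar R :=
  ereal_sup [set (`|f x| / W x)%:E | x in [set: T]].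

Definition sublevel (T : Type) (R : realType) (V : T -> R) (v : R) : set T :=
  [set x | (V x <= v)%R].

(* Main.v *)
Require Import Defs.
From HB Require Import structures.
From mathcomp Require Import all_boot all_order all_algebra.
From mathcomp Require Import all_classical all_reals all_analysis.
From mathcomp Require Import measurable_realfun ring lra.

(** Two copies of the chain started at [x] and [x'] get within reach of each
other because of the drift, and merge on a level set because of the
minorization. This picture is made rigorous without constructing a coupling,
through the duality between oscillation seminorms and kernels: if
[|h y - h y'| <= G y + G y'] for all [y, y'], then
[|P h x - P h x'| <= P G x + P G x'], and when [P x] and [P x'] share a
component [eps * nu] one may subtract [2 * eps * nu G], hence [2 * eps * t] if
[t <= G]. The reason is that [h] is within [G] of a constant. This is
[Rintegral_osc_le]; everything happens on the state space itself.

For the weighted sum, signs are chosen so that the absolute values at the fixed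
pair [x, x'] disappear. The sum is then the oscillation between [x] and [x'] of
one function, which satisfies a backward recursion with one kernel per step
([tail_sum]). By backward induction it is bounded by [G_0 x + G_0 x'] as soon as
functions [G_k] are found with
  [cost_k x + cost_k x' + contraction of G_(k+1) at (x, x') <= G_k x + G_k x'],
where [cost_k] is [(k + 1)] to the rate, times [|f|]; this is
[sum_kernel_prod_osc_le].

Such functions are multiples of the time-dependent Lyapunov function
[(tau_k + (V + M) `^ (1 - alpha)) `^ p] with [tau_k = T + kappa * k] and
[p = (1 - lambda * alpha) / (1 - alpha)]. It is concave in [V], so the drift of
[V] passes to it by tangent lines ([lyap_step]), and it decreases by a multiple
of [S = (tau_(k+1) + (V + M) `^ (1 - alpha)) `^ (p - 1)] where [V] is large. There
are two cases ([lyap_pair_contraction]). If one point of the pair is outside the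
level set of [M], its decrease pays for the other point, provided that [M] is
large and [kappa] small. If both are inside, merging removes
[2 * eps * tau_(k+1) `^ p], which beats [S], there of order
[tau_(k+1) `^ (p - 1)], once the clock starts late enough, that is, once [T] is
large. Finally [S] dominates both
[(k + 1) `^ (p - 1)] and [V `^ ((1 - alpha) * (p - 1))] up to constants, hence
also their geometric interpolation with parameter [xi], which is the summand;
and [G_0] is at most a multiple of [V `^ (1 - lambda * alpha)]. *)

Import Order.TTheory GRing.Theory Num.Theory.
Import numFieldNormedType.Exports.

Set Implicit Arguments.
Unset Strict Implicit.
Unset Printing Implicit Defensive.

Local Open Scope classical_set_scope.
Local Open Scope ring_scope.

(** * Tangent inequalities for real powers *)

Lemma powR_le_tangent (R : realType) (a x : R) :
  0 <= x -> 0 <= a -> a <= 1 -> x `^ a <= 1 + a * (x - 1).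
Proof.
move=> x0; rewrite le_eqVlt => /predU1P[<- _|a0].
  by rewrite powRr0 mul0r addr0.
rewrite le_eqVlt => /predU1P[->|a1]; first by rewrite powRr1// mul1r subrKC.
have na0 : 0 < 1 - a by rewrite subr_gt0.
have := @conjugate_powR R (x `^ a) 1 a^-1 (1 - a)^-1 (powR_ge0 _ _) ler01.
rewrite !invr_gt0 !invrK => /(_ a0 na0 (subrKC _ _)).
by rewrite mulr1 -powRrM mulfV ?gt_eqF// powRr1// powR1; lra.
Qed.

Lemma powR_ge_tangent (R : realType) (a x : R) :
  0 <= x -> 1 <= a -> 1 + a * (x - 1) <= x `^ a.
Proof.
move=> x0 a1; have a0 : 0 < a by lra.
have := @powR_le_tangent R a^-1 (x `^ a) (powR_ge0 _ _).
rewrite invr_ge0 (ltW a0) invf_le1// => /(_ isT a1).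
rewrite -powRrM mulfV ?gt_eqF// powRr1// mulrC -lerBlDl => h.
by rewrite -lerBrDl mulrC -ler_pdivlMr.
Qed.

Lemma powR_convex01 (R : realType) (r th w : R) : 1 <= r -> 0 <= w ->
  0 <= th -> th <= 1 -> (1 - th + th * w) `^ r <= 1 - th + th * w `^ r.
Proof.
move=> r1 w0 th0 th1.
have := @convex_powR R r r1 (Itv01 th0 th1) w 1.
rewrite !inE/= !in_itv/= !andbT => /(_ w0 ler01).
rewrite convRE [X in X `^ _ <= _ -> _]convRE/= /unstable.onem powR1 !mulr1.
by rewrite ![_ + (1 - th)]addrC.
Qed.

(** For [q = 1 - alpha] and [p * q <= 1] the map [t |-> (tau + t `^ q) `^ p] is
concave, and the right-hand side is its tangent at [u]. Tangents are used
instead of Jensen's inequality: they are affine in [t], so integrating them only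
needs the mean of [t]. Concavity follows by normalizing to [u = 1], from
concavity of [x `^ (p * q)] and convexity of [w `^ q^-1]. *)
Lemma powR_sum_le_tangent (R : realType) (p q tau t u : R) :
  1 <= p -> 0 < q -> p * q <= 1 -> 0 <= tau -> 0 <= t -> 0 < u ->
  (tau + t `^ q) `^ p <=
  (tau + u `^ q) `^ p +
    p * q * (tau + u `^ q) `^ (p - 1) * u `^ (q - 1) * (t - u).
Proof.
move=> p1 q0 pq1 tau0 t0 u0.
have uq0 : 0 < u `^ q by exact: powR_gt0.
set a := tau + u `^ q; have a0 : 0 < a by rewrite ltr_wpDl.
(* Dividing by the value at u leaves the variable y = t / u and the
   relative weight th of the moving term. *)
pose y := t / u; pose w := y `^ q; pose th := u `^ q / a.
have y0 : 0 <= y by rewrite divr_ge0// ltW.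
have th0 : 0 <= th by rewrite divr_ge0 ?ltW.
have th1 : th <= 1 by rewrite ler_pdivrMr// mul1r lerDr.
have ty : t = u * y by rewrite /y mulrCA mulfV ?gt_eqF// mulr1.
have -> : tau + t `^ q = a * (1 - th + th * w).
  have ath : a * th = u `^ q by rewrite /th mulrCA mulfV ?gt_eqF// mulr1.
  rewrite mulrDr mulrBr mulrA ath mulr1 ty powRM ?(ltW u0)// -/w /a; ring.
have z0 : 0 <= 1 - th + th * w by rewrite addr_ge0 ?subr_ge0// mulr_ge0// powR_ge0.
rewrite powRM ?(ltW a0)//.
have -> : a `^ p + p * q * a `^ (p - 1) * u `^ (q - 1) * (t - u) =
          a `^ p * (1 + p * q * (th * (y - 1))).
  rewrite -(@mulr_powRB1 _ a p) ?(ltW a0) ?(lt_le_trans ltr01 p1)//.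
  have -> : th = u * u `^ (q - 1) / a by rewrite mulr_powRB1// ltW.
  rewrite ty; field; exact: lt0r_neq0.
rewrite ler_wpM2l ?powR_ge0//.
have x0 : 0 <= (1 - th + th * w) `^ q^-1 by exact: powR_ge0.
have -> : (1 - th + th * w) `^ p = (1 - th + th * w) `^ q^-1 `^ (p * q).
  by rewrite -powRrM mulrCA mulVf ?gt_eqF// mulr1.
have pq0 : 0 <= p * q by rewrite mulr_ge0 ?(ltW q0)//; lra.
apply: (le_trans (powR_le_tangent x0 pq0 pq1)).
rewrite lerD2l ler_wpM2l// lerBlDr.
have q1 : q <= 1.
  by apply: le_trans pq1; rewrite ler_peMl// ltW.
have := @powR_convex01 R q^-1 th w; rewrite invf_ge1//.
move=> /(_ q1 (powR_ge0 _ _) th0 th1).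
rewrite /w -(powRrM y) mulfV ?gt_eqF// powRr1// => /le_trans; apply.
lra.
Qed.

(** The cost of advancing the clock by [k]; the derivative is taken at the far
end because that is where the drift of the Lyapunov function is evaluated. *)
Lemma powR_add_le (R : realType) (p a k : R) : 1 <= p -> 0 <= a -> 0 <= k ->
  (a + k) `^ p <= a `^ p + p * k * (a + k) `^ (p - 1).
Proof.
move=> p1 a0 k0; have p0 : 0 < p by lra.
have [->|ak] := eqVneq (a + k) 0.
  by rewrite powR0 ?gt_eqF// addr_ge0 ?powR_ge0// !mulr_ge0 ?powR_ge0// ltW.
have ak0 : 0 < a + k by rewrite lt0r ak addr_ge0.
have -> : a `^ p = (a + k) `^ p * (a / (a + k)) `^ p.
  by rewrite -powRM ?divr_ge0 ?(ltW ak0)// mulrCA mulfV// mulr1.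
have := @powR_ge_tangent R p (a / (a + k)); rewrite divr_ge0 ?(ltW ak0)//.
move=> /(_ isT p1) /(ler_wpM2l (powR_ge0 (a + k) p)).
rewrite -lerBlDr; apply: le_trans.
rewrite -(@mulr_powRB1 _ (a + k) p) ?(ltW ak0)// le_eqVlt; apply/orP; left.
apply/eqP; field; exact: ak.
Qed.

(** * Oscillation of integrals under a common minorant *)

Section oscillation.
Context d (X : measurableType d) (R : realType).
Implicit Types (mu nu : {measure set X -> \bar R}) (f g G h : X -> R).

Lemma integral_minorize mu nu (eps : R) (f : X -> \bar R) : 0 <= eps ->
  (forall A, measurable A -> (eps%:E * nu A <= mu A)%E) ->
  measurable_fun [set: X] f -> (forall x, 0 <= f x)%E ->
  (eps%:E * \int[nu]_x f x <= \int[mu]_x f x)%E.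
Proof.
move=> eps0 numu mf f0.
have <- := @ge0_integral_mscale _ _ _ nu setT measurableT (NngNum eps0) f mf
  (fun x _ => f0 x).
exact: ge0_le_measure_integral.
Qed.

(** A bound on differences by [G y + G y'] is a bound on the distance to one
constant, namely [sup (h - G)]. This is what makes an argument about pairs of
points one-dimensional. *)
Lemma center_of_osc_le G h (x0 : X) :
  (forall y y', `|h y - h y'| <= G y + G y') ->
  exists c, forall y, `|h y - c| <= G y.
Proof.
move=> hG; pose S := [set h y - G y | y in setT].
have ubS y : ubound S (h y + G y).
  move=> _ [z _ <-]; have := hG z y; rewrite ler_norml => /andP[_]; lra.
have S0 : S !=set0 by exists (h x0 - G x0); exists x0.
exists (sup S) => y; rewrite ler_distl; apply/andP; split.
  by rewrite lerBlDr; exact: ge_sup.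
rewrite -lerBlDr; apply: ub_le_sup; last by exists y.
by exists (h x0 + G x0); exact: ubS.
Qed.

(** Analytic form of coupling. After centring, [G - g] and [G + g] are both
nonnegative, so the common component [eps * nu] of [mu] and [mu'] contributes at
least [eps] times the [nu]-integral of [(G - g) + (G + g) = 2 G] to
[mu (G - g) + mu' (G + g)]: the part of [g] is lost on the coupled mass. With
[eps = 0] this is the bound for two independent moves. *)
Lemma Rintegral_sub_osc_le mu mu' nu G h (eps t : R) (x0 : X) :
  mu setT = 1%E -> mu' setT = 1%E -> nu setT = 1%E -> 0 <= eps ->
  (forall A, measurable A -> (eps%:E * nu A <= mu A)%E) ->
  (forall A, measurable A -> (eps%:E * nu A <= mu' A)%E) ->
  mu.-integrable setT (EFin \o G) -> mu'.-integrable setT (EFin \o G) ->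
  measurable_fun [set: X] h -> 0 <= t ->
  (forall y, t <= G y) -> (forall y y', `|h y - h y'| <= G y + G y') ->
  \int[mu]_y h y - \int[mu']_y h y <=
  \int[mu]_y G y + \int[mu']_y G y - 2 * (eps * t).
Proof.
move=> mu1 mu'1 nu1 eps0 numu numu' iG iG' mh t0 tG hG.
have [c hc] := center_of_osc_le x0 hG.
pose g y := h y - c.
have Gg_ge0 y : 0 <= G y - g y.
  by have := hc y; rewrite ler_norml /g => /andP[]; lra.
have gG_ge0 y : 0 <= G y + g y.
  by have := hc y; rewrite ler_norml /g => /andP[]; lra.
have mg : measurable_fun [set: X] g by exact: measurable_funB.
have mG : measurable_fun [set: X] G by apply/measurable_EFinP; case/integrableP: iG.
have ic (m : {measure set X -> \bar R}) :
    m setT = 1%E -> m.-integrable setT (EFin \o cst c).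
  move=> m1; apply/integrableP; split; first exact/measurable_EFinP.
  by rewrite /= integral_cst// m1 mule1 ltry.
have ig (m : {measure set X -> \bar R}) : m.-integrable setT (EFin \o G) ->
    m.-integrable setT (EFin \o g).
  apply: le_integrable => //; first exact/measurable_EFinP.
  by move=> y _; rewrite lee_fin (le_trans (hc y))// ler_norm.
have hE (m : {measure set X -> \bar R}) :
    m setT = 1%E -> m.-integrable setT (EFin \o G) ->
    \int[m]_y h y = \int[m]_y g y + c.
  move=> m1 mGi.
  transitivity (\int[m]_y (g y + cst c y)).
    by apply: eq_Rintegral => y _; rewrite /g subrK.
  by rewrite RintegralD//; [rewrite Rintegral_cst// m1 mulr1|exact: ig|exact: ic].
have dm : (eps%:E * \int[nu]_y (G y - g y)%:E <=
    (\int[mu]_y G y - \int[mu]_y g y)%:E)%E.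
  rewrite -RintegralB//; last exact: ig.
  rewrite fineK; last first.
    apply: integrable_fin_num => //.
    have := integrableB measurableT iG (ig _ iG); exact: eq_integrable.
  apply: integral_minorize => //.
  by apply/measurable_EFinP; exact: measurable_funB.
have dm' : (eps%:E * \int[nu]_y (G y + g y)%:E <=
    (\int[mu']_y G y + \int[mu']_y g y)%:E)%E.
  rewrite -RintegralD//; last exact: ig.
  rewrite fineK; last first.
    apply: integrable_fin_num => //.
    have := integrableD measurableT iG' (ig _ iG'); exact: eq_integrable.
  apply: integral_minorize => //.
  by apply/measurable_EFinP; exact: measurable_funD.
have dnu : ((2 * (eps * t))%:E <= eps%:E * \int[nu]_y (G y - g y)%:E +
    eps%:E * \int[nu]_y (G y + g y)%:E)%E.
  rewrite -ge0_muleDr; last 2 first.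
  - by apply: integral_ge0 => y _; rewrite lee_fin.
  - by apply: integral_ge0 => y _; rewrite lee_fin.
  rewrite mulrCA EFinM; apply: lee_wpmul2l; first by rewrite lee_fin.
  rewrite -ge0_integralD//; last 4 first.
  - by move=> y _; rewrite lee_fin.
  - by apply/measurable_EFinP; exact: measurable_funB.
  - by move=> y _; rewrite lee_fin.
  - by apply/measurable_EFinP; exact: measurable_funD.
  have <- : (\int[nu]_(y in [set: X]) (2 * t)%:E = (2 * t)%:E)%E.
    by rewrite integral_cst// nu1 mule1.
  apply: ge0_le_integral => //.
  - by move=> y _; rewrite lee_fin mulr_ge0.
  - apply: emeasurable_funD; apply/measurable_EFinP; first exact: measurable_funB.
    exact: measurable_funD.
  - move=> y _; rewrite -EFinD lee_fin; have := tG y; lra.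
rewrite !hE//; have := le_trans dnu (leeD dm dm'); rewrite -EFinD lee_fin; lra.
Qed.

Lemma Rintegral_osc_le mu mu' nu G h (eps t : R) (x0 : X) :
  mu setT = 1%E -> mu' setT = 1%E -> nu setT = 1%E -> 0 <= eps ->
  (forall A, measurable A -> (eps%:E * nu A <= mu A)%E) ->
  (forall A, measurable A -> (eps%:E * nu A <= mu' A)%E) ->
  mu.-integrable setT (EFin \o G) -> mu'.-integrable setT (EFin \o G) ->
  measurable_fun [set: X] h -> 0 <= t ->
  (forall y, t <= G y) -> (forall y y', `|h y - h y'| <= G y + G y') ->
  `|\int[mu]_y h y - \int[mu']_y h y| <=
  \int[mu]_y G y + \int[mu']_y G y - 2 * (eps * t).
Proof.
move=> mu1 mu'1 nu1 eps0 numu numu' iG iG' mh t0 tG hG.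
rewrite ler_norml lerNl opprB [X in X <= _ - _]addrC -[\int[mu']_y h y](opprK).
rewrite [- _ + - - _]addrC opprK; apply/andP; split.
  by rewrite [X in _ <= X - _]addrC; exact: (Rintegral_sub_osc_le x0 _ _ nu1).
exact: (Rintegral_sub_osc_le x0 _ _ nu1).
Qed.
End oscillation.

(** * Kernels acting on dominated functions, and backward summation *)

Lemma ge0_integral_kcomp_noparam d (X : measurableType d) (R : realType)
    (k l : R.-pker X ~> X) (f : X -> \bar R) (x : X) :
  (forall y, 0 <= f y)%E -> measurable_fun [set: X] f ->
  (\int[mkcomp_noparam k l x]_z f z = \int[k x]_y \int[l y]_z f z)%E.
Proof.
move=> f0 mf.
rewrite -(@integral_kcomp _ _ _ _ _ _ _ k (kernel.kernel_snd l) x f)//.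
Qed.

Section kernels.
Context d (X : measurableType d) (R : realType) (V : X -> R).
Hypotheses (mV : measurable_fun [set: X] V) (V_ge1 : forall x, 1 <= V x).
Implicit Types (mu : {measure set X -> \bar R}) (P : R.-pker X ~> X)
  (h : X -> R).

(** The class of functions on which all kernels below act: it is stable under
them and consists of functions integrable for every product kernel. *)
Definition dominated h :=
  measurable_fun [set: X] h /\ exists c, forall x, `|h x| <= c * V x.

Let V_ge0 x : 0 <= V x. Proof. exact: le_trans (V_ge1 x). Qed.

Lemma dominatedD h g : dominated h -> dominated g ->
  dominated (fun x => h x + g x).
Proof.
move=> [mh [c hc]] [mg [e ge]]; split; first exact: measurable_funD.
exists (c + e) => x; rewrite mulrDl (le_trans (ler_normD _ _))//.
exact: lerD.
Qed.

Lemma dominatedZ (a : R) h : dominated h -> dominated (fun x => a * h x).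
Proof.
move=> [mh [c hc]]; split; first exact: measurable_funM.
by exists (`|a| * c) => x; rewrite normrM -mulrA ler_wpM2l.
Qed.

Lemma dominated0 : dominated (fun=> 0).
Proof.
by split; [exact: measurable_cst|exists 0 => x; rewrite normr0 mul0r].
Qed.

Lemma dominated_integrable mu h : mu.-integrable setT (EFin \o V) ->
  dominated h -> mu.-integrable setT (EFin \o h).
Proof.
move=> iV [mh [c hc]].
apply: (@le_integrable _ _ _ mu setT measurableT _ (fun x => c%:E * (EFin \o V) x)%E).
- exact/measurable_EFinP.
- move=> x _; rewrite -[leRHS]/(`|c * V x|%:E) lee_fin.
  by rewrite (le_trans (hc x))// ler_norm.
- exact: integrableZl.
Qed.

Lemma integrable_drift mu (r : R) : (\int[mu]_y (V y)%:E <= r%:E)%E ->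
  mu.-integrable setT (EFin \o V).
Proof.
move=> Vr; apply/integrableP; split; first exact/measurable_EFinP.
under eq_integral => y _ do rewrite /= ger0_norm//.
by rewrite (le_lt_trans Vr)// ltry.
Qed.

Lemma measurable_Rintegral_kernel P h : measurable_fun [set: X] h ->
  measurable_fun [set: X] (fun x => \int[P x]_y h y).
Proof.
move=> mh; apply: measurableT_comp => //=.
have mI (f : X -> \bar R) : (forall y, 0 <= f y)%E -> measurable_fun [set: X] f ->
    measurable_fun [set: X] (fun x => \int[P x]_y f y)%E.
  move=> f0 mf; apply: measurable_fun_integral_kernel => //.
  exact: measurable_kernel.
have mhE : measurable_fun [set: X] (EFin \o h) by exact/measurable_EFinP.
rewrite (_ : (fun x => _) = (fun x => \int[P x]_y ((EFin \o h)^\+ y) -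
    \int[P x]_y ((EFin \o h)^\- y))%E); last first.
  by apply/funext => x; rewrite integralE.
apply: emeasurable_funB; apply: mI => //.
  exact: measurable_funepos.
exact: measurable_funeneg.
Qed.

Section one_kernel.
Variables (P : R.-pker X ~> X) (b : R).
Hypotheses (b_ge0 : 0 <= b)
  (PV : forall x, (kernel_app P V x <= (V x + b)%:E)%E).

Lemma kernel_integrable x : (P x).-integrable setT (EFin \o V).
Proof. exact: integrable_drift (PV x). Qed.

Lemma Rintegral_kernel_le x (r : R) : (kernel_app P V x <= r%:E)%E ->
  \int[P x]_y V y <= r.
Proof.
move=> Pr; rewrite -lee_fin fineK//.
exact: (integrable_fin_num measurableT (kernel_integrable x)).
Qed.

Lemma dominated_Rintegral_kernel h : dominated h ->
  dominated (fun x => \int[P x]_y h y).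
Proof.
move=> dh; have [mh [c hc]] := dh; split; first exact: measurable_Rintegral_kernel.
have c0 : 0 <= c.
  have := le_trans (normr_ge0 _) (hc point); rewrite pmulr_lge0//.
  exact: lt_le_trans (V_ge1 _).
exists (c * (1 + b)) => x.
have ih := dominated_integrable (kernel_integrable x) dh.
apply: (le_trans (le_normr_Rintegral measurableT ih)).
apply: (@le_trans _ _ (\int[P x]_y (c * V y))).
  apply: le_Rintegral => //.
  - exact: integrable_norm ih.
  - by have := integrableZl measurableT c (kernel_integrable x).
rewrite RintegralZl//; last exact: kernel_integrable.
rewrite -mulrA ler_wpM2l// (le_trans (Rintegral_kernel_le (PV x)))//.
by rewrite mulrDl mul1r lerD2l ler_peMr.
Qed.

End one_kernel.

Section products.
Variables (P : nat -> R.-pker X ~> X) (b : R).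
Hypotheses (b_ge0 : 0 <= b)
  (PV : forall k x, (1 <= k)%N -> (kernel_app (P k) V x <= (V x + b)%:E)%E).

Lemma kernel_prod_V_le n x :
  (kernel_app (kernel_prod P n) V x <= (V x + n%:R * b)%:E)%E.
Proof.
elim: n => [|n IH].
  by rewrite /kernel_app/= integral_dirac ?diracT ?mul1e ?mul0r ?addr0//;
    exact/measurable_EFinP.
rewrite /kernel_app/= ge0_integral_kcomp_noparam//; last exact/measurable_EFinP.
have : (\int[kernel_prod P n x]_y (\int[P n.+1 y]_z (V z)%:E) <=
    \int[kernel_prod P n x]_y ((V y)%:E + b%:E))%E.
  apply: ge0_le_integral => //.
  - by move=> y _; apply: integral_ge0 => z _; rewrite lee_fin.
  - apply: measurable_fun_integral_kernel => //; first exact: measurable_kernel.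
    exact/measurable_EFinP.
  - by apply: emeasurable_funD => //; exact/measurable_EFinP.
  - by move=> y _; rewrite -EFinD; exact: PV.
move=> /le_trans; apply; rewrite ge0_integralD//; last 2 first.
- by move=> y _; rewrite lee_fin.
- exact/measurable_EFinP.
rewrite integral_cst// prob_kernel mule1 (le_trans (leeD2r _ IH))//.
by rewrite -EFinD lee_fin -addrA -[n.+1]addn1 natrD mulrDl mul1r.
Qed.

Lemma kernel_prod_integrable n x : (kernel_prod P n x).-integrable setT (EFin \o V).
Proof. exact: integrable_drift (kernel_prod_V_le n x). Qed.

Lemma Rintegral_kernel_prodS n x h : dominated h ->
  \int[kernel_prod P n.+1 x]_y h y =
  \int[kernel_prod P n x]_y \int[P n.+1 y]_z h z.
Proof.
move=> dh; have iP y : (P n.+1 y).-integrable setT (EFin \o V).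
  exact: integrable_drift (PV y (ltn0Sn n)).
have dP g : dominated g -> dominated (fun y => \int[P n.+1 y]_z g z).
  by move=> dg; apply: (dominated_Rintegral_kernel b_ge0 _ dg) => y; exact: PV.
have ge0 g : dominated g -> (forall y, 0 <= g y) ->
    \int[kernel_prod P n.+1 x]_y g y =
    \int[kernel_prod P n x]_y \int[P n.+1 y]_z g z.
  move=> dg g0; rewrite /Rintegral/= ge0_integral_kcomp_noparam//; last first.
    by apply/measurable_EFinP; case: dg.
  congr fine; apply: eq_integral => y _; rewrite fineK//.
  apply: integrable_fin_num => //.
  exact: dominated_integrable (iP y) dg.
pose hp y := Num.max (h y) 0; pose hn y := Num.max (- h y) 0.
have hE y : h y = hp y - hn y.
  by rewrite /hp /hn; case: leP => ?; case: leP => ?; lra.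
have [mh [c hc]] := dh.
have dp : dominated hp.
  split; first exact: measurable_maxr.
  exists c => y; apply: le_trans (hc y).
  by rewrite /hp; case: (leP (h y)) => _; rewrite ?normr0.
have dn : dominated hn.
  split; first by apply: measurable_maxr => //; exact: measurableT_comp.
  exists c => y; apply: le_trans (hc y).
  by rewrite /hn; case: (leP (- h y)) => _; rewrite ?normr0 ?normrN.
have split_int (mu : {measure set X -> \bar R}) :
    mu.-integrable setT (EFin \o V) ->
    \int[mu]_y h y = \int[mu]_y hp y - \int[mu]_y hn y.
  move=> iV; rewrite -RintegralB//; [|exact: dominated_integrable..].
  by apply: eq_Rintegral => y _.
rewrite split_int; last exact: kernel_prod_integrable.
rewrite !ge0//; [|by move=> y; rewrite le_max lexx orbT..].
rewrite -RintegralB//; last 2 first.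
- by apply: dominated_integrable (dP _ dp); exact: kernel_prod_integrable.
- by apply: dominated_integrable (dP _ dn); exact: kernel_prod_integrable.
by apply: eq_Rintegral => y _; rewrite split_int.
Qed.

Section backward.
Variables (f : X -> R) (r : nat -> R) (G : nat -> X -> R).
Hypotheses (df : dominated f) (r_ge0 : forall k, 0 <= r k)
  (G_ge0 : forall k x, 0 <= G k x)
  (G_step : forall k h, dominated h ->
     (forall y y', `|h y - h y'| <= G k.+1 y + G k.+1 y') ->
     forall x x', r k * (`|f x| + `|f x'|) +
       `|\int[P k.+1 x]_y h y - \int[P k.+1 x']_y h y| <= G k x + G k x').

(** [tail_sum a m k] is the sum over [k <= n < k + m] of
[a n * P_(k+1) ... P_n f]. Written as a backward recursion it involves a single
kernel per step, so that oscillation bounds propagate from [k + 1] to [k]. *)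
Fixpoint tail_sum (a : nat -> R) (m k : nat) : X -> R :=
  match m with
  | 0%N => fun=> 0
  | m'.+1 => fun x => a k * f x + \int[P k.+1 x]_y tail_sum a m' k.+1 y
  end.

Lemma dominated_tail_sum a m k : dominated (tail_sum a m k).
Proof.
elim: m k => [|m IH] k /=; first exact: dominated0.
apply: dominatedD; first exact: dominatedZ.
by apply: (dominated_Rintegral_kernel b_ge0 _ (IH k.+1)) => y; exact: PV.
Qed.

Lemma tail_sum_osc a m k : (forall i, `|a i| <= r i) ->
  forall x x', `|tail_sum a m k x - tail_sum a m k x'| <= G k x + G k x'.
Proof.
move=> ar; elim: m k => [|m IH] k x x' /=.
  by rewrite subrr normr0 addr_ge0.
apply: le_trans (G_step (dominated_tail_sum a m k.+1) (IH k.+1) x x').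
rewrite opprD addrACA (le_trans (ler_normD _ _))// lerD2r -mulrBr normrM.
by rewrite ler_pM// ler_normB.
Qed.

Lemma Rintegral_tail_sum a m k x :
  \int[kernel_prod P k x]_y tail_sum a m k y =
  \sum_(i < m) a (k + i)%N * \int[kernel_prod P (k + i) x]_y f y.
Proof.
elim: m k => [|m IH] k.
  by rewrite big_ord0 /= Rintegral_cst// mul0r.
rewrite /= RintegralD//; last 2 first.
- exact: dominated_integrable (kernel_prod_integrable k x) (dominatedZ _ df).
- apply: dominated_integrable (kernel_prod_integrable k x) _.
  apply: (dominated_Rintegral_kernel b_ge0 _ (dominated_tail_sum a m k.+1)) => y.
  exact: PV.
rewrite RintegralZl//; last first.
  exact: dominated_integrable (kernel_prod_integrable k x) df.
rewrite -Rintegral_kernel_prodS; last exact: dominated_tail_sum.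
rewrite IH big_ord_recl addn0; congr (_ + _).
by apply: eq_bigr => i _; rewrite lift0 addSnnS.
Qed.

(** With [a n = +- r n] chosen so as to realize the absolute values at the
fixed pair [x, x'], the whole weighted sum is the oscillation of one function,
to which the backward induction applies. *)
Lemma sum_kernel_prod_osc_le N x x' :
  \sum_(i < N) r i * `|\int[kernel_prod P i x]_y f y -
                       \int[kernel_prod P i x']_y f y| <= G 0 x + G 0 x'.
Proof.
pose D i := \int[kernel_prod P i x]_y f y - \int[kernel_prod P i x']_y f y.
pose a i := r i * Num.sg (D i).
have ar i : `|a i| <= r i.
  by rewrite normrM ger0_norm// ler_piMr// normr_sg; case: (_ != _).
have tail0 z : tail_sum a N 0 z =
    \sum_(i < N) a i * \int[kernel_prod P i z]_y f y.
  rewrite -(Rintegral_tail_sum a N 0) /Rintegral/= integral_dirac//.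
    by rewrite diracT mul1e.
  by apply/measurable_EFinP; case: (dominated_tail_sum a N 0).
rewrite (le_trans _ (tail_sum_osc N 0 ar x x'))// !tail0 -sumrB.
rewrite (le_trans _ (ler_norm _))// ler_sum// => i _.
by rewrite -mulrBr -/(D i) -mulrA -normrEsg.
Qed.

End backward.
End products.
End kernels.

(** * The time-dependent Lyapunov function *)

Lemma drift_out_arith (R : realFieldType) (eta s s' l l' a a' : R) :
  0 <= eta -> 0 <= s' -> s <= s' ->
  a <= l + 2 * eta * s -> a' <= l' - 7 * eta * s' ->
  a + a' + 2 * eta * (s + s') <= l + l'.
Proof.
move=> eta0 s'0 ss' al al'.
by have := ler_wpM2l eta0 ss'; have := mulr_ge0 eta0 s'0; lra.
Qed.

Lemma drift_in_arith (R : realFieldType) (eta s s' l l' a a' e : R) :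
  4 * eta * s <= e -> 4 * eta * s' <= e ->
  a <= l + 2 * eta * s -> a' <= l' + 2 * eta * s' ->
  a + a' - 2 * e + 2 * eta * (s + s') <= l + l'.
Proof. lra. Qed.

Lemma scale_arith (R : realFieldType) (A t s l a a' e n : R) :
  0 <= A -> a + a' - 2 * (e * t) + s <= l ->
  n <= A * a + A * a' - 2 * (e * (A * t)) -> A * s + n <= A * l.
Proof. by move=> A0 /(ler_wpM2l A0); lra. Qed.

Section lyapunov.
Context d (X : measurableType d) (R : realType) (V : X -> R).
Hypotheses (mV : measurable_fun [set: X] V) (V_ge1 : forall x, 1 <= V x).
Variables (alpha p M kappa : R).
Hypotheses (alpha_gt0 : 0 < alpha) (alpha_lt1 : alpha < 1) (p_ge1 : 1 <= p)
  (ps : p * (1 - alpha) <= 1) (M_ge1 : 1 <= M) (kappa_ge0 : 0 <= kappa).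

(** Up to normalization, [lyap tau] is the classical time-dependent drift
function [v |-> H^-1 (tau + H v)] with [H' = 1 / v `^ alpha], raised to a power
and evaluated at [V + M]. A larger [p], up to [1 / (1 - alpha)], asks for a
higher moment of [V] and gives a faster rate. The shift by [M] flattens the function
near the bottom: a point where [V] is small then gains, per step, only a small
multiple of what a point with large [V] loses. Without it, the gain of the lower
point of a pair could beat the loss of the higher one, because the loss relative
to [lyap_base `^ (p - 1)] does not improve with [V]. *)
Definition lyap_base (tau : R) (x : X) : R := tau + (V x + M) `^ (1 - alpha).
Definition lyap (tau : R) (x : X) : R := lyap_base tau x `^ p.

Let V_ge0 x : 0 <= V x. Proof. exact: le_trans (V_ge1 x). Qed.

Let VM_gt0 x : 0 < V x + M.
Proof. by have := V_ge1 x; have := M_ge1; lra. Qed.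

Lemma lyap_base_gt0 tau x : 0 <= tau -> 0 < lyap_base tau x.
Proof. by move=> tau0; rewrite ltr_wpDl// powR_gt0. Qed.

Lemma lyap_ge0 tau x : 0 <= lyap tau x. Proof. exact: powR_ge0. Qed.

Lemma lyap_ge tau x : 0 <= tau -> tau `^ p <= lyap tau x.
Proof.
move=> tau0; apply: ge0_ler_powR; rewrite ?nnegrE ?(ltW (lyap_base_gt0 _ _))//.
  exact: le_trans p_ge1.
by rewrite lerDl powR_ge0.
Qed.

Lemma lyap_tangent tau (u : R) x : 0 <= tau -> 0 < u ->
  lyap tau x <= (tau + u `^ (1 - alpha)) `^ p +
    p * (1 - alpha) * (tau + u `^ (1 - alpha)) `^ (p - 1) * u `^ (- alpha) *
    (V x + M - u).
Proof.
move=> tau0 u0.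
have := @powR_sum_le_tangent R p (1 - alpha) tau (V x + M) u p_ge1.
rewrite subr_gt0 => /(_ alpha_lt1 ps tau0 (ltW (VM_gt0 _)) u0).
by rewrite (_ : 1 - alpha - 1 = - alpha)//; ring.
Qed.

(** Growth at most linear in [V]: the graph lies below a tangent. *)
Lemma dominated_lyap tau : 0 <= tau -> dominated V (lyap tau).
Proof.
move=> tau0; split.
  apply: (@measurableT_comp _ _ _ _ _ _ (@powR R ^~ p)); first exact: measurable_powR.
  apply: measurable_funD => //.
  apply: (@measurableT_comp _ _ _ _ _ _ (@powR R ^~ (1 - alpha))).
    exact: measurable_powR.
  exact: measurable_funD.
have u0 : 0 < 1 + M by have := M_ge1; lra.
set c0 := (tau + (1 + M) `^ (1 - alpha)) `^ p.
set c1 := p * (1 - alpha) * (tau + (1 + M) `^ (1 - alpha)) `^ (p - 1) *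
  (1 + M) `^ (- alpha).
have c0_ge0 : 0 <= c0 by exact: powR_ge0.
have c1_ge0 : 0 <= c1.
  rewrite !mulr_ge0 ?powR_ge0 ?subr_ge0 ?(ltW alpha_lt1)//.
  exact: le_trans p_ge1.
exists (c0 + c1) => x; rewrite ger0_norm ?lyap_ge0//.
apply: (le_trans (lyap_tangent x tau0 u0)); rewrite mulrDl lerD//.
  by rewrite ler_peMr.
by rewrite ler_wpM2l// opprD addrACA subrr addr0 lerBlDr lerDl.
Qed.

Section one_step.
Variables (P : R.-pker X ~> X) (tau : R) (x : X).
Hypotheses (tau_ge0 : 0 <= tau) (iV : (P x).-integrable setT (EFin \o V)).

Let S := lyap_base (tau + kappa) x `^ (p - 1).

(** The tangent at [V x + M] is integrated; its slope there is
[p * (1 - alpha) * S * (V x + M) `^ (- alpha)], and the clock costs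
[p * kappa * S]. *)
Lemma lyap_step :
  \int[P x]_y lyap (tau + kappa) y <= lyap tau x +
    S * (p * kappa + p * (1 - alpha) * (V x + M) `^ (- alpha) *
         (\int[P x]_y V y - V x)).
Proof.
have tk0 : 0 <= tau + kappa by rewrite addr_ge0.
set c1 := p * (1 - alpha) * S * (V x + M) `^ (- alpha).
have icst (c : R) : (P x).-integrable setT (EFin \o cst c).
  apply: dominated_integrable iV _ => //; split => //.
  by exists `|c| => y; rewrite ler_peMr.
have Pcst (c : R) : \int[P x]_y cst c y = c.
  by rewrite Rintegral_cst// prob_kernel mulr1.
have iVc : (P x).-integrable setT (EFin \o (fun y => V y - cst (V x) y)).
  by have := integrableB measurableT iV (icst (V x)); exact: eq_integrable.
have iR : (P x).-integrable setT (EFin \o (fun y => c1 * (V y - cst (V x) y))).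
  by have := integrableZl measurableT c1 iVc; exact: eq_integrable.
have iL : (P x).-integrable setT (EFin \o
    (fun y => cst (lyap (tau + kappa) x) y + c1 * (V y - cst (V x) y))).
  have := integrableD measurableT (icst (lyap (tau + kappa) x)) iR.
  exact: eq_integrable.
apply: (@le_trans _ _ (lyap (tau + kappa) x + c1 * (\int[P x]_y V y - V x))).
  have <- : \int[P x]_y (cst (lyap (tau + kappa) x) y + c1 * (V y - cst (V x) y)) =
      lyap (tau + kappa) x + c1 * (\int[P x]_y V y - V x).
    by rewrite RintegralD// RintegralZl// RintegralB// !Pcst.
  apply: le_Rintegral => //.
    exact: dominated_integrable iV (dominated_lyap tk0).
  move=> y _ /=; apply: le_trans (lyap_tangent y tk0 (VM_gt0 x)) _.
  rewrite /lyap /S /lyap_base /c1 lerD2l.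
  by rewrite opprD addrACA subrr addr0.
rewrite (_ : lyap tau x + _ = lyap tau x + p * kappa * S +
    c1 * (\int[P x]_y V y - V x)); last by rewrite /c1; ring.
rewrite lerD2r /lyap /S /lyap_base addrAC.
apply: powR_add_le => //; exact/ltW/lyap_base_gt0.
Qed.

Lemma lyap_step_low (b eta : R) : 0 <= b -> p * kappa = eta ->
  b * M `^ (- alpha) <= eta -> \int[P x]_y V y <= V x + b ->
  \int[P x]_y lyap (tau + kappa) y <= lyap tau x + 2 * eta * S.
Proof.
move=> b0 pk bM PVb; apply: (le_trans lyap_step); rewrite lerD2l mulrC.
rewrite ler_wpM2r ?powR_ge0// pk mulr2n mulrDl mul1r lerD2l.
have s0 : 0 <= p * (1 - alpha).
  by rewrite mulr_ge0 ?subr_ge0 ?(ltW alpha_lt1)// (le_trans _ p_ge1).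
apply: le_trans bM; rewrite -mulrA [leRHS]mulrC.
apply: (@le_trans _ _ (p * (1 - alpha) * ((V x + M) `^ (- alpha) * b))).
  by rewrite !ler_wpM2l ?powR_ge0// lerBlDl.
rewrite (le_trans (ler_piMl _ ps)) ?mulr_ge0 ?powR_ge0//.
rewrite ler_wpM2r// !powRN lef_pV2 ?posrE ?powR_gt0 ?(lt_le_trans _ M_ge1)//.
apply: ge0_ler_powR; rewrite ?nnegrE ?(ltW alpha_gt0)// ?(le_trans _ M_ge1)//.
  exact/ltW/VM_gt0.
by rewrite lerDr.
Qed.

(** Far out, [V x + M <= 2 * V x], so the factor [(V x + M) `^ (- alpha)] of the
slope makes of the drift [beta * V x `^ alpha] at least [beta / 2], and
[8 * eta - eta = 7 * eta] is left after paying for the clock. *)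
Lemma lyap_step_high (beta eta : R) : 0 <= beta -> p * kappa = eta ->
  p * (1 - alpha) * beta / 2 = 8 * eta -> M <= V x ->
  \int[P x]_y V y <= V x - beta * V x `^ alpha ->
  \int[P x]_y lyap (tau + kappa) y <= lyap tau x - 7 * eta * S.
Proof.
move=> beta0 pk beta_eta MV PVb; apply: (le_trans lyap_step).
rewrite lerD2l mulrC -mulNr ler_wpM2r ?powR_ge0// pk.
have s0 : 0 <= p * (1 - alpha).
  by rewrite mulr_ge0 ?subr_ge0 ?(ltW alpha_lt1)// (le_trans _ p_ge1).
have VU : 2^-1 <= (V x + M) `^ (- alpha) * V x `^ alpha.
  have U0 := VM_gt0 x.
  have -> : (V x + M) `^ (- alpha) * V x `^ alpha = (V x / (V x + M)) `^ alpha.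
    have -> : V x `^ alpha = (V x / (V x + M)) `^ alpha * (V x + M) `^ alpha.
      by rewrite -powRM ?divr_ge0 ?(ltW U0)// divfK ?gt_eqF.
    by rewrite mulrCA powRN mulVf ?mulr1// gt_eqF// powR_gt0.
  have h2 : 0 < (2^-1 : R) <= 1 by apply/andP; split; lra.
  apply: (le_trans (ger1_powR h2 (ltW alpha_lt1))).
  apply: ge0_ler_powR; rewrite ?nnegrE ?divr_ge0 ?(ltW alpha_gt0) ?(ltW U0)//.
  by rewrite ler_pdivlMr//; move: MV; lra.
apply: (@le_trans _ _ (eta - p * (1 - alpha) * beta / 2)); last first.
  by rewrite beta_eta; lra.
rewrite lerD2l.
apply: (@le_trans _ _ (p * (1 - alpha) * (V x + M) `^ (- alpha) *
  (- (beta * V x `^ alpha)))).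
  apply: ler_wpM2l; first exact: mulr_ge0 s0 (powR_ge0 _ _).
  by rewrite lerBlDl.
rewrite mulrN lerN2.
have -> : p * (1 - alpha) * (V x + M) `^ (- alpha) * (beta * V x `^ alpha) =
  p * (1 - alpha) * beta * ((V x + M) `^ (- alpha) * V x `^ alpha) by ring.
by apply: ler_wpM2l => //; rewrite mulr_ge0.
Qed.

End one_step.

Section pair_step.
Variables (P : R.-pker X ~> X) (b beta eta eps tau : R) (nu : probability X R).
Hypotheses (b_ge0 : 0 <= b) (beta_ge0 : 0 <= beta) (eps_gt0 : 0 < eps)
  (tau_ge0 : 0 <= tau) (pkappa : p * kappa = eta)
  (bM : b * M `^ (- alpha) <= eta)
  (beta_eta : p * (1 - alpha) * beta / 2 = 8 * eta)
  (PVb : forall x, (kernel_app P V x <= (V x + b)%:E)%E)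
  (PV_drift : forall x, M < V x ->
     (kernel_app P V x <= (V x - beta * V x `^ alpha)%:E)%E)
  (P_minor : forall x, V x <= M ->
     forall A, measurable A -> (eps%:E * nu A <= P x A)%E)
  (tau_M : (2 * M) `^ (1 - alpha) <= tau + kappa)
  (tau_eps : 4 * eta * 2 `^ (p - 1) <= eps * (tau + kappa)).

Let S x := lyap_base (tau + kappa) x `^ (p - 1).

Let iV x : (P x).-integrable setT (EFin \o V).
Proof. exact: integrable_drift (PVb x). Qed.

Let eta_ge0 : 0 <= eta.
Proof. by rewrite -pkappa mulr_ge0// (le_trans _ p_ge1). Qed.

Let tk_ge0 : 0 <= tau + kappa. Proof. exact: addr_ge0. Qed.

Let S_ge0 x : 0 <= S x. Proof. exact: powR_ge0. Qed.

Let PL x := \int[P x]_y lyap (tau + kappa) y.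

Let low x : PL x <= lyap tau x + 2 * eta * S x.
Proof.
apply: (lyap_step_low tau_ge0 (iV x) b_ge0) => //.
exact: (Rintegral_kernel_le mV V_ge1 PVb).
Qed.

Let high x : M < V x -> PL x <= lyap tau x - 7 * eta * S x.
Proof.
move=> MV; apply: (lyap_step_high tau_ge0 (iV x) beta_ge0) => //; first exact: ltW.
by apply: (Rintegral_kernel_le mV V_ge1 PVb); exact: PV_drift.
Qed.

Let S_mono x x' : V x <= V x' -> S x <= S x'.
Proof.
move=> xx'; have tk := tk_ge0; have p1 : 0 <= p - 1 by rewrite subr_ge0.
apply: ge0_ler_powR; rewrite ?nnegrE ?(ltW (lyap_base_gt0 _ _))//.
rewrite lerD2l; apply: ge0_ler_powR; rewrite ?nnegrE ?subr_ge0 ?(ltW alpha_lt1)//.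
- exact: ltW.
- exact: ltW.
- by rewrite lerD2r.
Qed.

(** The drift of the higher point pays for the lower one: [S] is monotone in
[V], and [7 - 2 >= 2 + 2] times [eta * S] remains. *)
Let lyap_pair_out x x' : V x <= V x' -> M < V x' ->
  PL x + PL x' + 2 * eta * (S x + S x') <= lyap tau x + lyap tau x'.
Proof.
move=> xx' Mx'.
exact: (drift_out_arith eta_ge0 (S_ge0 x') (S_mono xx') (low x) (high Mx')).
Qed.

(** No decrease is guaranteed on the level set of [M]; the loss
[2 * eps * (tau + kappa) `^ p] due to coupling wins since it is of higher order
in the clock than [S <= (2 * (tau + kappa)) `^ (p - 1)]. *)
Let lyap_pair_in x x' : V x <= M -> V x' <= M ->
  PL x + PL x' - 2 * (eps * (tau + kappa) `^ p) + 2 * eta * (S x + S x') <=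
  lyap tau x + lyap tau x'.
Proof.
move=> xM x'M.
have tk := tk_ge0; have p1 : 0 <= p - 1 by rewrite subr_ge0.
have M0 : 0 <= M by rewrite (le_trans _ M_ge1).
have SM z : V z <= M -> S z <= 2 `^ (p - 1) * (tau + kappa) `^ (p - 1).
  move=> zM; rewrite -powRM//.
  apply: ge0_ler_powR; rewrite ?nnegrE ?mulr_ge0 ?(ltW (lyap_base_gt0 _ _))//.
  rewrite mulr2n mulrDl mul1r lerD2l (le_trans _ tau_M)//.
  apply: ge0_ler_powR; rewrite ?nnegrE ?subr_ge0 ?(ltW alpha_lt1) ?mulr_ge0//.
    exact: ltW.
  by rewrite mulr2n mulrDl mul1r lerD2r.
have e4 z : V z <= M -> 4 * eta * S z <= eps * (tau + kappa) `^ p.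
  move=> zM; rewrite -(@mulr_powRB1 _ (tau + kappa) p)//; last first.
    by rewrite (lt_le_trans _ p_ge1).
  rewrite mulrA; apply: le_trans (ler_wpM2r _ tau_eps); last exact: powR_ge0.
  rewrite -[leRHS]mulrA; apply: ler_wpM2l; last exact: SM.
  by rewrite mulr_ge0.
exact: (drift_in_arith (e4 _ xM) (e4 _ x'M) (low x) (low x')).
Qed.

(** The pair step: in one move the oscillation bound improves by a multiple of
[S x + S x'], which is the budget for one term of the weighted sum. *)
Lemma lyap_pair_contraction (A : R) h x x' : 0 <= A -> dominated V h ->
  (forall y y', `|h y - h y'| <=
     A * lyap (tau + kappa) y + A * lyap (tau + kappa) y') ->
  A * (2 * eta) * (S x + S x') + `|\int[P x]_y h y - \int[P x']_y h y| <=
  A * lyap tau x + A * lyap tau x'.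
Proof.
move=> A0 [mh _] hosc.
have dL := dominated_lyap tk_ge0.
have iL z : (P z).-integrable setT (EFin \o (fun y => A * lyap (tau + kappa) y)).
  exact: dominated_integrable (iV z) (dominatedZ _ dL).
have AL z : \int[P z]_y (A * lyap (tau + kappa) y) = A * PL z.
  by rewrite RintegralZl//; exact: dominated_integrable (iV z) dL.
have At : 0 <= A * (tau + kappa) `^ p by rewrite mulr_ge0 ?powR_ge0.
have AtL y : A * (tau + kappa) `^ p <= A * lyap (tau + kappa) y.
  by rewrite ler_wpM2l// lyap_ge.
rewrite -mulrA -mulrDr.
suff [e [e0 eP eP' eL]] : exists e, [/\ 0 <= e,
    forall B, measurable B -> (e%:E * nu B <= P x B)%E,
    forall B, measurable B -> (e%:E * nu B <= P x' B)%E &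
    PL x + PL x' - 2 * (e * (tau + kappa) `^ p) + 2 * eta * (S x + S x') <=
      lyap tau x + lyap tau x'].
  have hle := Rintegral_osc_le x (prob_kernel x) (prob_kernel x')
    (@probability_setT _ _ _ nu) e0 eP eP' (iL x) (iL x') mh At AtL hosc.
  rewrite !AL in hle.
  exact: (scale_arith A0 eL hle).
have e0P z B : measurable B -> (0%:E * nu B <= P z B)%E by rewrite mul0e.
have [xx'|x'x] := leP (V x) (V x');
  [have [x'M|Mx'] := leP (V x') M|have [xM|Mx] := leP (V x) M].
- have xM : V x <= M by exact: le_trans xx' x'M.
  exists eps; split; [exact: ltW|exact: P_minor|exact: P_minor|].
  exact: lyap_pair_in.
- exists 0; split => //; [exact: e0P..|].
  by rewrite mul0r mulr0 subr0; exact: lyap_pair_out.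
- have x'M : V x' <= M by exact: le_trans (ltW x'x) xM.
  exists eps; split; [exact: ltW|exact: P_minor|exact: P_minor|].
  exact: lyap_pair_in.
- exists 0; split => //; [exact: e0P..|].
  rewrite mul0r mulr0 subr0 [PL x + _]addrC [S x + _]addrC [leRHS]addrC.
  by apply: lyap_pair_out => //; exact: ltW.
Qed.

End pair_step.
End lyapunov.

(** * Subgeometric rates *)

Section rate.
Context d (X : measurableType d) (R : realType) (V : X -> R).
Hypotheses (mV : measurable_fun [set: X] V) (V_ge1 : forall x, 1 <= V x).

(** The budget splits as [xi] to [1 - xi] between time and space, as
[lyap_base] dominates both [kappa * (k + 1)] and [V `^ (1 - alpha)]. *)
Lemma rate_weight_le_lyap (alpha p M kappa tau xi : R) (k : nat) (x : X) :
  alpha < 1 -> 1 <= p -> 1 <= M -> 0 <= kappa -> 0 <= tau -> 0 <= xi -> xi <= 1 ->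
  kappa `^ ((p - 1) * xi) *
    (k.+1%:R `^ ((p - 1) * xi) * V x `^ ((1 - alpha) * (p - 1) * (1 - xi))) <=
  lyap_base V alpha M (kappa * k.+1%:R + tau) x `^ (p - 1).
Proof.
move=> a1 p1 M1 kap0 tau0 xi0 xi1.
have V0 := V_ge1 x; have M0 : 0 <= M by exact: le_trans M1.
have pxi : 0 <= (p - 1) * xi by rewrite mulr_ge0// subr_ge0.
have pxi' : 0 <= (p - 1) * (1 - xi) by rewrite mulr_ge0// subr_ge0.
have kk : 0 <= kappa * k.+1%:R by rewrite mulr_ge0.
have base0 : 0 < lyap_base V alpha M (kappa * k.+1%:R + tau) x.
  by apply: lyap_base_gt0; rewrite ?addr_ge0.
have -> : p - 1 = (p - 1) * xi + (p - 1) * (1 - xi) by ring.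
rewrite powRD; last by rewrite (gt_eqF base0) implybT.
have -> : (p - 1) * xi + (p - 1) * (1 - xi) = p - 1 by ring.
rewrite mulrA ler_pM ?mulr_ge0 ?powR_ge0//.
  rewrite -powRM//; apply: ge0_ler_powR; rewrite ?nnegrE ?(ltW base0)//.
  by rewrite /lyap_base -addrA lerDl addr_ge0 ?powR_ge0.
rewrite -mulrA [leLHS]powRrM.
apply: ge0_ler_powR; rewrite ?nnegrE ?powR_ge0 ?(ltW base0)//.
apply: (@le_trans _ _ ((V x + M) `^ (1 - alpha))).
  apply: ge0_ler_powR; rewrite ?nnegrE ?subr_ge0 ?lerDl ?(ltW a1)//; lra.
by rewrite lerDr addr_ge0.
Qed.

Lemma lyap_le_powR (alpha p M tau : R) (x : X) :
  alpha < 1 -> 0 <= p -> 0 <= M -> 0 <= tau ->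
  lyap V alpha p M tau x <=
    (tau + (1 + M) `^ (1 - alpha)) `^ p * V x `^ (p * (1 - alpha)).
Proof.
move=> a1 p0 M0 tau0; have V1 := V_ge1 x.
have V0 : 0 <= V x by lra.
have q0 : 0 <= 1 - alpha by lra.
have -> : V x `^ (p * (1 - alpha)) = (V x `^ (1 - alpha)) `^ p.
  by rewrite -powRrM mulrC.
have c0 : 0 <= tau + (1 + M) `^ (1 - alpha) by rewrite addr_ge0 ?powR_ge0.
have <- : ((tau + (1 + M) `^ (1 - alpha)) * V x `^ (1 - alpha)) `^ p =
    (tau + (1 + M) `^ (1 - alpha)) `^ p * (V x `^ (1 - alpha)) `^ p.
  by rewrite powRM// powR_ge0.
rewrite /lyap /lyap_base.
apply: ge0_ler_powR => //; rewrite ?nnegrE ?mulr_ge0 ?powR_ge0//.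
  by rewrite addr_ge0 ?powR_ge0.
rewrite mulrDl lerD//.
  rewrite ler_peMr// -[leLHS](powRr0 (V x)); exact: ler_powR.
rewrite -powRM//; last lra.
apply: ge0_ler_powR => //; rewrite ?nnegrE ?mulr_ge0 ?addr_ge0//.
by rewrite mulrDl mul1r lerD2l ler_peMr.
Qed.

Variables (Pcal : set (R.-pker X ~> X)) (alpha beta b v0 p : R).
Hypotheses (alpha_gt0 : 0 < alpha) (alpha_lt1 : alpha < 1) (beta_gt0 : 0 < beta)
  (b_ge0 : 0 <= b) (p_ge1 : 1 <= p) (ps : p * (1 - alpha) <= 1)
  (drift_bounded : forall P, Pcal P -> forall x,
     (kernel_app P V x <= (V x + b)%:E)%E)
  (drift_far : forall P, Pcal P -> forall x, v0 < V x ->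
     (kernel_app P V x <= (V x - beta * V x `^ alpha)%:E)%E)
  (minor : forall v : R, exists2 eps : R, 0 < eps &
     forall P, Pcal P -> exists nu : probability X R,
       forall x, sublevel V v x ->
       forall A, measurable A -> (eps%:E * nu A <= P x A)%E).

(** The order of the choices matters: [eta] and [kappa] depend on the drift
only, then [M] is fixed, which determines the minorization constant [eps], and
the starting time [T] of the clock comes last, so large that coupling on the
level set of [M] pays for a step despite a small [eps]. *)
Lemma subgeometric_sum_le (xi : R) : 0 <= xi -> xi <= 1 ->
  exists2 c : R, 0 <= c &
  forall P : nat -> R.-pker X ~> X, (forall k, (1 <= k)%N -> Pcal (P k)) ->
  forall (f : X -> R) (F : R), measurable_fun [set: X] f -> 0 <= F ->
  (forall x, `|f x| <= F * V x `^ ((1 - alpha) * (p - 1) * (1 - xi))) ->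
  dominated V f /\
  forall N x x',
  \sum_(i < N) i.+1%:R `^ ((p - 1) * xi) *
     `|\int[kernel_prod P i x]_y f y - \int[kernel_prod P i x']_y f y| <=
  c * F * (V x `^ (p * (1 - alpha)) + V x' `^ (p * (1 - alpha)) - 1).
Proof.
move=> xi0 xi1.
have p0 : 0 < p by exact: lt_le_trans p_ge1.
have q0 : 0 < 1 - alpha by rewrite subr_gt0.
pose eta := p * (1 - alpha) * beta / 16.
have eta0 : 0 < eta by rewrite divr_gt0// !mulr_gt0.
have beta_eta : p * (1 - alpha) * beta / 2 = 8 * eta by rewrite /eta; field.
pose kappa := eta / p.
have kappa0 : 0 < kappa by rewrite divr_gt0.
have pk : p * kappa = eta by rewrite /kappa mulrCA mulfV ?mulr1// gt_eqF.
(* Beyond v0 the drift is available; the last bound makes the possible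
   increase b of V cost at most eta. *)
pose M := Num.max (Num.max 1 v0) ((b / eta) `^ alpha^-1).
have M1 : 1 <= M by rewrite !le_max lexx.
have M0 : 0 <= M by exact: le_trans M1.
have Mv0 : v0 <= M by rewrite !le_max lexx orbT.
have bM : b * M `^ (- alpha) <= eta.
  rewrite powRN ler_pdivrMr ?powR_gt0 ?(lt_le_trans _ M1)// mulrC -ler_pdivrMr//.
  have be0 : 0 <= b / eta by rewrite divr_ge0// ltW.
  rewrite -[leLHS]powRr1// -[X in _ `^ X <= _](@mulVf _ alpha) ?gt_eqF// powRrM.
  apply: ge0_ler_powR; rewrite ?nnegrE ?powR_ge0 ?(ltW alpha_gt0)//.
  by rewrite le_max lexx orbT.
have [eps eps0 min] := minor M.
pose T := Num.max ((2 * M) `^ (1 - alpha)) (4 * eta * 2 `^ (p - 1) / eps).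
have TM : (2 * M) `^ (1 - alpha) <= T by rewrite le_max lexx.
have Teps : 4 * eta * 2 `^ (p - 1) / eps <= T by rewrite le_max lexx orbT.
have T0 : 0 <= T by rewrite (le_trans _ TM)// powR_ge0.
pose ck := kappa `^ ((p - 1) * xi).
have ck0 : 0 < ck by rewrite powR_gt0.
pose D := (T + (1 + M) `^ (1 - alpha)) `^ p.
have D0 : 0 <= D by exact: powR_ge0.
exists (D / (eta * ck)); first by rewrite divr_ge0// mulr_ge0// ltW.
move=> P PP f F mf F0 fF.
have df : dominated V f.
  split=> //; exists F => x; rewrite (le_trans (fF x))// ler_wpM2l//.
  rewrite ler1_powR// mulr_ile1 ?mulr_ge0 ?subr_ge0 ?(ltW alpha_lt1)//; last first.
    by rewrite gerBl.
  by move: ps alpha_gt0 => h1 h2; rewrite mulrBr mulr1 mulrC; lra.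
split=> // N x x'.
(* A step of the pair yields A * (2 * eta) * S at each of its points; ck is what
   is lost in bounding the summand by S. *)
pose A := F / (2 * eta * ck).
have A0 : 0 <= A by rewrite divr_ge0 ?mulr_ge0// ltW.
pose tau k := kappa * k%:R + T.
have tauS k : tau k.+1 = tau k + kappa by rewrite /tau -[k.+1]addn1 natrD; ring.
have tau0 k : 0 <= tau k.
  by apply: addr_ge0 => //; apply: mulr_ge0 => //; exact: ltW.
have PV k y : (1 <= k)%N -> (kernel_app (P k) V y <= (V y + b)%:E)%E.
  by move=> k1; apply: drift_bounded; exact: PP.
apply: (@le_trans _ _ (A * lyap V alpha p M (tau 0) x +
                       A * lyap V alpha p M (tau 0) x')).
  apply: (@sum_kernel_prod_osc_le _ _ _ V mV V_ge1 P b b_ge0 PV f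
    (fun k => k.+1%:R `^ ((p - 1) * xi))
    (fun k y => A * lyap V alpha p M (tau k) y) df).
  - by move=> k; exact: powR_ge0.
  - by move=> k y; apply: (mulr_ge0 A0); exact: lyap_ge0.
  - move=> k h dh hosc y y'.
    have Pk : Pcal (P k.+1) by exact: PP.
    have [nu nuP] := min _ Pk.
    have tk : (2 * M) `^ (1 - alpha) <= tau k + kappa.
      by rewrite -tauS (le_trans TM)// lerDr mulr_ge0// ltW.
    have te : 4 * eta * 2 `^ (p - 1) <= eps * (tau k + kappa).
      rewrite [leRHS]mulrC -ler_pdivrMr// -tauS (le_trans Teps)// lerDr.
      by rewrite mulr_ge0// ltW.
    have far z : M < V z ->
        (kernel_app (P k.+1) V z <= (V z - beta * V z `^ alpha)%:E)%E.
      by move=> Mz; apply: drift_far => //; exact: le_lt_trans Mz.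
    rewrite tauS in hosc.
    have := @lyap_pair_contraction _ _ _ V mV V_ge1 alpha p M kappa alpha_gt0 alpha_lt1
      p_ge1 ps M1 (ltW kappa0) (P k.+1) b beta eta eps (tau k) nu b_ge0 (ltW beta_gt0)
      eps0 (tau0 k) pk bM beta_eta (drift_bounded Pk) far nuP tk te A h y y' A0 dh hosc.
    apply: le_trans; rewrite lerD2r.
    have cost z : k.+1%:R `^ ((p - 1) * xi) * `|f z| <=
        A * (2 * eta) * lyap_base V alpha M (tau k + kappa) z `^ (p - 1).
      have := rate_weight_le_lyap k z alpha_lt1 p_ge1 M1 (ltW kappa0) T0 xi0 xi1.
      rewrite -/(tau k.+1) tauS -/ck => /(ler_wpM2l F0) le1.
      have := ler_wpM2l (powR_ge0 k.+1%:R ((p - 1) * xi)) (fF z) => /le_trans; apply.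
      have -> : A * (2 * eta) = F / ck.
        by rewrite /A; field; rewrite !gt_eqF.
      rewrite [leRHS]mulrAC ler_pdivlMr//; apply: le_trans le1.
      by rewrite le_eqVlt; apply/orP; left; apply/eqP; ring.
    by rewrite !mulrDr lerD.
have le_tau0 z := lyap_le_powR z alpha_lt1 (ltW p0) M0 T0.
have VS z : 1 <= V z `^ (p * (1 - alpha)).
  by rewrite -[leLHS](powRr0 (V z)) ler_powR// mulr_ge0// ltW.
rewrite /tau !mulr0 !add0r -mulrDr.
apply: (le_trans (ler_wpM2l A0 (lerD (le_tau0 x) (le_tau0 x')))).
rewrite -/D -mulrDr.
have -> : D / (eta * ck) * F = A * D * 2 by rewrite /A; field; rewrite !gt_eqF.
rewrite mulrA -[leRHS]mulrA; apply: ler_wpM2l; first exact: mulr_ge0.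
by have := VS x; have := VS x'; lra.
Qed.
End rate.

Local Open Scope ereal_scope.

Lemma wnorm_fin (T : Type) (R : realType) (W f : T -> R) (x0 : T) :
  (forall x, 0 < W x)%R -> wnorm W f < +oo ->
  exists F : R, [/\ wnorm W f = F%:E, (0 <= F)%R &
                    forall x, (`|f x| <= F * W x)%R].
Proof.
move=> W0; rewrite /wnorm; set S := ereal_sup _ => Sy.
have ubS x : (`|f x| / W x)%:E <= S by apply: ereal_sup_ubound; exists x.
have S0 : 0 <= S.
  by apply: le_trans (ubS x0); rewrite lee_fin divr_ge0// ltW.
have SE : S = (fine S)%:E by rewrite fineK// ge0_fin_numE.
exists (fine S); split => //; first exact: fine_ge0.
by move=> x; have := ubS x; rewrite SE lee_fin ler_pdivrMr.
Qed.

Unset Implicit Arguments.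

Theorem corollary8 (R : realType) (d : measure_display) (X : measurableType d)
    (Pcal : set (R.-pker X ~> X))
    (C : set X) (V : X -> R) (beta alpha bV : R)
    (mC : measurable C)
    (mV : measurable_fun [set: X] V)
    (V_ge1 : forall x : X, (1 <= V x)%R)
    (cV_fin : ereal_sup [set (V x)%:E | x in C] < +oo)
    (beta_gt0 : (0 < beta)%R)
    (alpha_gt0 : (0 < alpha)%R) (alpha_lt1 : (alpha < 1)%R)
    (drift_out : forall P : R.-pker X ~> X, Pcal P -> forall x : X, ~ C x ->
       kernel_app P V x <= (V x - beta * V x `^ alpha)%:E)
    (drift_in : forall P : R.-pker X ~> X, Pcal P -> forall x : X, C x ->
       kernel_app P V x <= bV%:E)
    (minorization : forall v : R, exists2 eps : R, (0 < eps)%R &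
       forall P : R.-pker X ~> X, Pcal P -> exists nu : probability X R,
         forall x : X, sublevel V v x ->
         forall A : set X, measurable A -> eps%:E * nu A <= P x A) :
  forall xi lambda : R,
    (0 <= xi)%R -> (xi <= 1)%R -> (0 <= lambda)%R -> (lambda < 1)%R ->
  exists c : R,
  forall P : nat -> R.-pker X ~> X,
    (forall k : nat, (1 <= k)%N -> Pcal (P k)) ->
  forall f : X -> R, measurable_fun [set: X] f ->
  let W := fun x : X => (V x `^ (alpha * (1 - lambda) * (1 - xi)))%R in
    wnorm W f < +oo ->
  forall x x' : X,
    \sum_(0 <= n <oo)
      ((n.+1%:R `^ (alpha * (1 - lambda) * xi / (1 - alpha)))%:E *
       `| kernel_app (kernel_prod P n) f x - kernel_app (kernel_prod P n) f x' |)
    <= c%:E * wnorm W f *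
       (V x `^ (1 - lambda * alpha) + V x' `^ (1 - lambda * alpha) - 1)%:E.
Proof.
move=> xi lambda xi0 xi1 lambda0 lambda1.
have a0 : (0 < 1 - alpha)%R by rewrite subr_gt0.
(* This exponent gives the Lyapunov function the growth of
   V `^ (1 - lambda * alpha), hence the right-hand side. *)
pose p := ((1 - lambda * alpha) / (1 - alpha))%R.
have pa : (p * (1 - alpha) = 1 - lambda * alpha)%R.
  by rewrite /p divfK// gt_eqF.
have p1 : (p - 1 = alpha * (1 - lambda) / (1 - alpha))%R.
  by rewrite /p; field; rewrite gt_eqF.
have p_ge1 : (1 <= p)%R.
  by rewrite -subr_ge0 p1 divr_ge0 ?mulr_ge0 ?subr_ge0 ?ltW.
have pa1 : (p * (1 - alpha) <= 1)%R.
  by rewrite pa gerBl mulr_ge0// ltW.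
(* If C is empty, v0 is 0 and all points are outside C. *)
pose v0 := fine (ereal_sup [set (V x)%:E | x in C]).
have CV x : C x -> (V x <= v0)%R.
  move=> Cx; have ubV : (V x)%:E <= ereal_sup [set (V x)%:E | x in C].
    by apply: ereal_sup_ubound; exists x.
  rewrite -lee_fin fineK// fin_real// cV_fin andbT.
  by apply: lt_le_trans ubV; rewrite ltNyr.
pose b := Num.max bV 0%R.
have b0 : (0 <= b)%R by rewrite le_max lexx orbT.
have drift_bounded P : Pcal P -> forall x, kernel_app P V x <= (V x + b)%:E.
  move=> PP x; have [Cx|nCx] := pselect (C x).
    apply: le_trans (drift_in _ PP _ Cx) _; rewrite lee_fin.
    have := V_ge1 x; have : (bV <= b)%R by rewrite le_max lexx.
    by lra.
  apply: le_trans (drift_out _ PP _ nCx) _; rewrite lee_fin lerD2l.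
  by apply: le_trans b0; rewrite oppr_le0 mulr_ge0 ?powR_ge0// ltW.
have drift_far P : Pcal P -> forall x, (v0 < V x)%R ->
    kernel_app P V x <= (V x - beta * V x `^ alpha)%:E.
  by move=> PP x Vx; apply: drift_out => // /CV; rewrite leNgt Vx.
have [c c0 hc] := @subgeometric_sum_le d X R V mV V_ge1 Pcal alpha beta b v0 p
  alpha_gt0 alpha_lt1 beta_gt0 b0 p_ge1 pa1 drift_bounded drift_far minorization
  xi xi0 xi1.
exists c => P PP f mf W Wf x x'.
have V0 y : (0 < V y)%R by exact: lt_le_trans (V_ge1 y).
have W0 y : (0 < W y)%R by exact: powR_gt0.
have [F [-> F0 fF]] := @wnorm_fin X R W f x W0 Wf.
have eW : ((1 - alpha) * (p - 1) * (1 - xi) = alpha * (1 - lambda) * (1 - xi))%R.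
  by rewrite p1; field; rewrite gt_eqF.
have er : ((p - 1) * xi = alpha * (1 - lambda) * xi / (1 - alpha))%R.
  by rewrite p1 mulrAC.
have fF' y : (`|f y| <= F * V y `^ ((1 - alpha) * (p - 1) * (1 - xi)))%R.
  by rewrite eW; exact: fF.
have [df sum_le] := hc P PP f F mf F0 fF'.
have iV n y : (kernel_prod P n y).-integrable [set: X] (EFin \o V).
  apply: (kernel_prod_integrable mV V_ge1 b0) => k z k1.
  by apply: drift_bounded; exact: PP.
have appE n y : kernel_app (kernel_prod P n) f y =
    (\int[kernel_prod P n y]_z f z)%:E.
  rewrite fineK//; apply: integrable_fin_num => //.
  exact: dominated_integrable (iV n y) df.
apply: lime_le.
  by apply: is_cvg_nneseries => n _ _; rewrite mule_ge0 ?lee_fin ?powR_ge0.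
apply: nearW => N; rewrite big_mkord.
under eq_bigr => i _ do rewrite !appE -er.
rewrite -EFinM -pa.
have -> : \sum_(i < N) (i.+1%:R `^ ((p - 1) * xi))%:E *
    `|(\int[kernel_prod P i x]_z f z)%:E - (\int[kernel_prod P i x']_z f z)%:E| =
  (\sum_(i < N) i.+1%:R `^ ((p - 1) * xi) *
     `|\int[kernel_prod P i x]_y f y - \int[kernel_prod P i x']_y f y|)%R%:E.
  by rewrite -sumEFin; apply: eq_bigr => i _.
by rewrite lee_fin; exact: sum_le.
Qed.
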